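(* Let $n\in\mathbb{N}$, let $\mathbb{K}\in\{\mathbb{R},\mathbb{C}\}$, and let $f\in\mathbb{K}[[x]]^n$ be a formal vector field with $f(0)=0$ and linear part $B=Df(0)$, such that the semi-simple part $B_s$ of $B$ is diagonal, $B_s=\mathrm{diag}(\lambda_1,\dots,\lambda_n)$ with $\lambda_1,\dots,\lambda_n\in\mathbb{K}$. Assume that $f$ is in Poincaré–Dulac normal form. Let $I\subseteq\mathbb{K}[[x]]$ be an $L_f$-invariant ideal. Then $I$ is $L_{B_s}$-invariant.
   Context: $\mathbb{K}[[x]]=\mathbb{K}[[x_1,\dots,x_n]]$ is the ring of formal power series. A formal vector field $f$ with $f(0)=0$ has an expansion $f(x)=Bx+\sum_{j\ge 2}f^{(j)}(x)$ with $B=Df(0)\in\mathbb{K}^{n\times n}$ and $f^{(j)}$ a homogeneous polynomial vector field of degree $j$. Write $B=B_s+B_n$ for the Jordan–Chevalley decomposition of $B$ into commuting semi-simple part $B_s$ and nilpotent part $B_n$. The vector field $f$ is in Poincaré–Dulac normal form (PDNF) if the Lie bracket $[f,B_s]$ vanishes, i.e. $B_s\cdot f(x)-Df(x)\cdot B_s x=0$. For a formal vector field $h=(h_1,\dots,h_n)\in\mathbb{K}[[x]]^n$ the Lie derivative is $L_h(\psi)=D\psi\cdot h=\sum_{i=1}^n h_i\,\partial\psi/\partial x_i$ for $\psi\in\mathbb{K}[[x]]$. For a matrix $A\in\mathbb{K}^{n\times n}$, $L_A$ denotes $L_h$ for the linear vector field $h(x)=Ax$; thus $L_{B_s}(\psi)=\sum_{i=1}^n\lambda_i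 x_i\,\partial\psi/\partial x_i$. An ideal $I\subseteq\mathbb{K}[[x]]$ is called $L_h$-invariant if $L_h(I)\subseteq I$. *)

(* Defs.v *)
From HB Require Import structures.
From mathcomp Require Import all_boot all_order all_algebra.
From mathcomp Require Import mpoly complex.
From mathcomp Require Import boolp classical_sets reals.

Set Implicit Arguments.
Unset Strict Implicit.
Unset Printing Implicit Defensive.

Import GRing.Theory.
Local Open Scope ring_scope.

Variant base_field := RealField | ComplexField.

Definition scalars (R : realType) (k : base_field) : fieldType :=
  match k with
  | RealField => R
  | ComplexField => R[i]
  end.

(* A formal power series is the family of its coefficients, indexed by the
   exponents m : 'X_{1..n}; p = \sum_m p.[m] x^m. *)
Record fps (n : nat) (K : Type) := Fps { fps_coef : 'X_{1..n} -> K }.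

Notation "{ 'fps' K [ n ] }" := (fps n K)
  (at level 0, K at level 2, n at level 2, format "{ 'fps'  K [ n ] }")
  : type_scope.

Notation coef p m := (fps_coef p m).

HB.instance Definition _ n K := gen_eqMixin {fps K[n]}.
HB.instance Definition _ n K := gen_choiceMixin {fps K[n]}.

Section FpsRing.
Context (n : nat) (K : comNzRingType).
Implicit Types (p q r : {fps K[n]}) (m : 'X_{1..n}).

Lemma fpsP p q : (forall m, coef p m = coef q m) -> p = q.
Proof. by case: p q => [p] [q] /= pq; congr Fps; apply/funext. Qed.

Definition fps_add p q := Fps (fun m => coef p m + coef q m).
Definition fps_opp p : {fps K[n]} := Fps (fun m => - coef p m).
Definition fpsC (c : K) : {fps K[n]} := Fps (fun m => c *+ (m == 0%MM)).
Definition fpsX (i : 'I_n) : {fps K[n]} := Fps (fun m => (m == U_(i)%MM)%:R).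

(* Cauchy product; bounding the two degrees by that of m only makes the range
   of the sum finite. *)
Definition fps_mul p q := Fps (fun m =>
  \sum_(k : 'X_{1..n < (mdeg m).+1, (mdeg m).+1} | m == (k.1 + k.2)%MM)
    coef p k.1 * coef q k.2).

Fact fps_addA : associative fps_add.
Proof. by move=> p q r; apply: fpsP => m /=; rewrite addrA. Qed.
Fact fps_addC : commutative fps_add.
Proof. by move=> p q; apply: fpsP => m /=; rewrite addrC. Qed.
Fact fps_add0 : left_id (fpsC 0) fps_add.
Proof. by move=> p; apply: fpsP => m /=; rewrite mul0rn add0r. Qed.
Fact fps_addN : left_inverse (fpsC 0) fps_opp fps_add.
Proof. by move=> p; apply: fpsP => m /=; rewrite mul0rn addNr. Qed.

HB.instance Definition _ := GRing.isZmodule.Build {fps K[n]}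
  fps_addA fps_addC fps_add0 fps_addN.

Definition fps_trunc d p : {mpoly K[n]} :=
  \sum_(m : 'X_{1..n < d}) coef p m *: 'X_[m].

Lemma coef_trunc d p m : (mdeg m < d)%N -> (fps_trunc d p)@_m = coef p m.
Proof. exact: mcoeff_mpoly. Qed.

Lemma mdeg_summand m k1 k2 : m == (k1 + k2)%MM ->
  (mdeg k1 <= mdeg m)%N && (mdeg k2 <= mdeg m)%N.
Proof. by move=> /eqP ->; rewrite mdegD leq_addr leq_addl. Qed.

Lemma mcoeffM_eq (a a' b b' : {mpoly K[n]}) m :
    (forall k, (mdeg k <= mdeg m)%N -> a@_k = a'@_k) ->
    (forall k, (mdeg k <= mdeg m)%N -> b@_k = b'@_k) ->
  (a * b)@_m = (a' * b')@_m.
Proof.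
move=> aa' bb'; rewrite !mcoeffM; apply: eq_bigr => -[k1 k2] /mdeg_summand.
by case/andP=> k1m k2m; rewrite aa' ?bb'.
Qed.

Lemma coefM_trunc d p q m : (mdeg m < d)%N ->
  coef (fps_mul p q) m = (fps_trunc d p * fps_trunc d q)@_m.
Proof.
move=> md; rewrite mcoeffM; apply: eq_bigr => -[k1 k2] /mdeg_summand.
by case/andP=> k1m k2m; rewrite !coef_trunc // (leq_ltn_trans _ md).
Qed.

Fact fps_mulA : associative fps_mul.
Proof.
move=> p q r; apply: fpsP => m; set d := (mdeg m).+1.
rewrite !(@coefM_trunc d) //.
transitivity ((fps_trunc d p * (fps_trunc d q * fps_trunc d r))@_m).
  by apply: mcoeffM_eq => // k km; rewrite coef_trunc // (@coefM_trunc d).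
rewrite mulrA; apply: mcoeffM_eq => // k km.
by rewrite coef_trunc // (@coefM_trunc d).
Qed.

Fact fps_mulC : commutative fps_mul.
Proof.
move=> p q; apply: fpsP => m.
by rewrite !(@coefM_trunc (mdeg m).+1) // mulrC.
Qed.

Fact fps_mul1 : left_id (fpsC 1) fps_mul.
Proof.
move=> p; apply: fpsP => m; set d := (mdeg m).+1.
rewrite (@coefM_trunc d) // -(@coef_trunc d p m) // -[in RHS](mul1r (fps_trunc _ _)).
by apply: mcoeffM_eq => // k km; rewrite coef_trunc // mcoeff1.
Qed.

Fact fps_mulDl : left_distributive fps_mul fps_add.
Proof.
move=> p q r; apply: fpsP => m /=; rewrite -big_split /=.
by apply: eq_bigr => k _; rewrite mulrDl.
Qed.

Fact fps_oner_neq0 : fpsC 1 != fpsC 0.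
Proof.
apply/eqP => /(congr1 (fun p : {fps K[n]} => coef p 0%MM)) /=.
by rewrite eqxx !mulr1n; apply/eqP/oner_neq0.
Qed.

HB.instance Definition _ := GRing.Zmodule_isComNzRing.Build {fps K[n]}
  fps_mulA fps_mulC fps_mul1 fps_mulDl fps_oner_neq0.

Lemma coef0 m : coef (0 : {fps K[n]}) m = 0.
Proof. by rewrite /= mul0rn. Qed.

Lemma coefD p q m : coef (p + q) m = coef p m + coef q m.
Proof. by []. Qed.

Lemma coef_sum I (s : seq I) P (F : I -> {fps K[n]}) m :
  coef (\sum_(i <- s | P i) F i) m = \sum_(i <- s | P i) coef (F i) m.
Proof.
by elim/big_rec2: _ => [|i x y _ <-]; rewrite ?coef0 ?coefD.
Qed.

Lemma coefCM c p m : coef (fpsC c * p) m = c * coef p m.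
Proof.
rewrite (@coefM_trunc (mdeg m).+1) // -(@coef_trunc (mdeg m).+1 p) //.
rewrite -mcoeffCM; apply: mcoeffM_eq => // k km.
by rewrite coef_trunc // mcoeffC mulr_natr.
Qed.

Definition fps_deriv (i : 'I_n) p : {fps K[n]} :=
  Fps (fun m => coef p (m + U_(i))%MM *+ (m i).+1).

Lemma coef_deriv i p m :
  coef (fps_deriv i p) m = coef p (m + U_(i))%MM *+ (m i).+1.
Proof. by []. Qed.

(* Formal vector fields are column vectors of power series. *)
Implicit Types f g h : 'cV[{fps K[n]}]_n.

(* The Jacobian matrix Df. *)
Definition jacobian f : 'M[{fps K[n]}]_n :=
  \matrix_(i, j) fps_deriv j (f i 0).

(* Evaluation at the origin, entrywise on matrices of power series. *)
Definition at0 a b (F : 'M[{fps K[n]}]_(a, b)) : 'M[K]_(a, b) :=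
  map_mx (fun p => coef p 0%MM) F.

(* The vector field x |-> A x. *)
Definition linear_field (A : 'M[K]_n) : 'cV[{fps K[n]}]_n :=
  map_mx fpsC A *m \col_i fpsX i.

Definition lie_bracket f g : 'cV[{fps K[n]}]_n :=
  jacobian g *m f - jacobian f *m g.

Definition lie_derivative h p : {fps K[n]} :=
  \sum_(i < n) h i 0 * fps_deriv i p.

Lemma coef_linear_field (A : 'M[K]_n) i m :
  coef (linear_field A i 0) m = \sum_(k < n) A i k *+ (m == U_(k)%MM).
Proof.
rewrite mxE coef_sum; apply: eq_bigr => k _.
by rewrite !mxE coefCM -mulr_natr.
Qed.

Lemma jacobian_linear (A : 'M[K]_n) :
  jacobian (linear_field A) = map_mx fpsC A.
Proof.
apply/matrixP => i j; rewrite mxE [RHS]mxE; apply: fpsP => m.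
rewrite coef_deriv coef_linear_field (bigD1 j) //= big1 => [|k kj].
  rewrite addr0 -[X in _ == X]add0m eqm_add2r.
  by case: eqP => [->|_]; rewrite ?mnm0E ?mul0rn.
case: eqP => [/mnmP/(_ j)|//].
by rewrite mnmDE !mnm1E eqxx (negbTE kj) addn1.
Qed.

Lemma lie_bracket_linear f (A : 'M[K]_n) :
  lie_bracket f (linear_field A)
    = map_mx fpsC A *m f - jacobian f *m linear_field A.
Proof. by rewrite /lie_bracket jacobian_linear. Qed.

Lemma lie_derivative_diag (lambda : 'rV[K]_n) p :
  lie_derivative (linear_field (diag_mx lambda)) p
    = \sum_(i < n) fpsC (lambda 0 i) * fpsX i * fps_deriv i p.
Proof.
apply: eq_bigr => i _; congr (_ * _); rewrite mxE (bigD1 i) //= big1 => [|j ji].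
  by rewrite !mxE eqxx mulr1n addr0.
rewrite !mxE eq_sym (negbTE ji) mulr0n; exact: mul0r.
Qed.

(* The unit ideal is allowed, unlike in ring_quotient's idealr. *)
Definition is_ideal (I : set {fps K[n]}) :=
  [/\ I 0, forall p q, I p -> I q -> I (p + q) & forall a p, I p -> I (a * p)].

Definition lie_invariant h (I : set {fps K[n]}) :=
  forall p, I p -> I (lie_derivative h p).

End FpsRing.

Section JordanChevalley.
Context (n : nat) (K : fieldType).
Implicit Types A B : 'M[K]_n.

(* Every A-invariant subspace of K^n has an A-invariant complement.  Subspaces
   are row spaces and stablemx acts on the right on row vectors, so A^T gives
   the action of A on column vectors. *)
Definition semisimple_mx A :=
  forall V : 'M[K]_n, stablemx V A^T ->
  exists W : 'M[K]_n,
    [/\ stablemx W A^T, row_full (V + W)%MS & mxdirect (V + W)].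

Definition nilpotent_mx A := exists k : nat, A ^+ k = 0.

Definition jordan_chevalley B Bs Bn :=
  [/\ B = Bs + Bn, comm_mx Bs Bn, semisimple_mx Bs & nilpotent_mx Bn].

(* Poincare-Dulac normal form, Bs being the semisimple part of Df(0). *)
Definition poincare_dulac (f : 'cV[{fps K[n]}]_n) (Bs : 'M[K]_n) :=
  lie_bracket f (linear_field Bs) = 0.

End JordanChevalley.

(* Main.v *)
Require Import Defs.
From HB Require Import structures.
From mathcomp Require Import all_boot all_order all_algebra.
From mathcomp Require Import mpoly complex.
From mathcomp Require Import boolp classical_sets reals.

(* Write S = L_{B_s}, L = L_f, N = L - S.  The normal form condition says that
   f_i has weight lambda_i, so L preserves the eigenspaces of S (spanned by the
   monomials x^m with a given value of sum_i lambda_i m_i), and on the eigenspace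
   of mu one has L - mu = N.  Modulo every power of the maximal ideal M, the
   derivation N is nilpotent because its linear part B_n is.  Hence modulo M^d
   an eigencomponent of p for S is a generalized eigencomponent of p for L, and
   the L-stable space I + M^d contains all of them as soon as it contains p; so
   S p lies in I + M^d for all d.  Finally I is closed in the M-adic topology:
   by Dickson's lemma finitely many elements of I have lowest monomials
   dividing those of all elements of the closure of I, and dividing by them
   degree by degree converges. *)

Set Implicit Arguments.
Unset Strict Implicit.
Unset Printing Implicit Defensive.

Import Order.TTheory GRing.Theory Defs.
Local Open Scope ring_scope.

(** * Generalized eigencomponents of vectors in an invariant subspace *)

Section EigencomponentsInInvariantSubspace.
Context (K : fieldType) (V : lmodType K) (L : {linear V -> V}) (W : set V).
Hypotheses (W0 : W 0) (WD : forall u v, W u -> W v -> W (u + v)).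
Hypotheses (WZ : forall a u, W u -> W (a *: u)) (WL : forall u, W u -> W (L u)).
Implicit Types (a mu : K) (u v : V).

Definition shift a u := L u - a *: u.

Let WB u v : W u -> W v -> W (u - v).
Proof. by move=> Wu Wv; rewrite -scaleN1r; apply: WD => //; apply: WZ. Qed.

Lemma shift_mem a u : W u -> W (shift a u).
Proof. by move=> Wu; apply: WB; [apply: WL | apply: WZ]. Qed.

Lemma iter_shift_mem e a u : W u -> W (iter e (shift a) u).
Proof. by move=> Wu; elim: e => //= e; apply: shift_mem. Qed.

Lemma shiftC a b u : shift a (shift b u) = shift b (shift a u).
Proof.
have LZ c v : L (c *: v) = c *: L v by exact: linearZZ.
rewrite /shift !(raddfB L) /= !LZ !scalerBr.
rewrite !scalerA [b * a]mulrC !opprD !opprK !addrA.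
by congr (_ + _); rewrite addrAC.
Qed.

Lemma iter_shiftC e a b u :
  shift a (iter e (shift b) u) = iter e (shift b) (shift a u).
Proof. by elim: e => //= e <-; rewrite shiftC. Qed.

Lemma iter_shiftCC d e a b u :
  iter d (shift a) (iter e (shift b) u) = iter e (shift b) (iter d (shift a) u).
Proof. by elim: d => //= d ->; rewrite iter_shiftC. Qed.

Lemma iter_shiftB e a u v :
  iter e (shift a) (u - v) = iter e (shift a) u - iter e (shift a) v.
Proof.
elim: e => //= e ->; rewrite /shift (raddfB L) scalerBr !opprD !opprK !addrA.
by congr (_ + _); rewrite addrAC.
Qed.

Lemma shift_sum (J : Type) (s : seq J) a (F : J -> V) :
  shift a (\sum_(i <- s) F i) = \sum_(i <- s) shift a (F i).
Proof. by rewrite /shift raddf_sum scaler_sumr -sumrB. Qed.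

Lemma iter_shift_sum (J : Type) e (s : seq J) a (F : J -> V) :
  iter e (shift a) (\sum_(i <- s) F i) = \sum_(i <- s) iter e (shift a) (F i).
Proof. by elim: e => //= e ->; rewrite shift_sum. Qed.

(** The two shifts differ by the invertible scalar [a - mu], so [u] is a multiple of their
    difference; the induction on [e] supplies [shift mu u]. *)
Lemma mem_of_shift e a mu u : a != mu ->
  W (iter e (shift mu) u) -> W (shift a u) -> W u.
Proof.
move=> amu; elim: e u => // e IHe u; rewrite iterSr => We Wa.
have Wmu : W (shift mu u).
  by apply: IHe => //; rewrite shiftC; apply: shift_mem.
have /(WZ (a - mu)^-1) : W ((a - mu) *: u).
  have -> : (a - mu) *: u = shift mu u - shift a u.
    by rewrite scalerBl /shift opprB [RHS]addrC addrA subrK.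
  exact: WB.
by rewrite scalerA mulVf ?subr_eq0 // scale1r.
Qed.

Lemma mem_of_iter_shift d e a mu u : a != mu ->
  W (iter e (shift mu) u) -> W (iter d (shift a) u) -> W u.
Proof.
move=> amu We; elim: d => //= d IHd Wd.
apply: IHd; apply: mem_of_shift amu _ Wd.
by rewrite iter_shiftCC; apply: iter_shift_mem We.
Qed.

(** Being a generalized eigenvector is required of [q i] only modulo [W], which spares a quotient
    space. A power of [shift (mu j)] disposes of the head [j], the induction hypothesis treats the
    transformed tail, and [mem_of_iter_shift] undoes the power since [mu i] differs from [mu j]. *)
Lemma mem_eigencomponent (J : eqType) (mu : J -> K) (q : J -> V) e (s : seq J) :
    uniq [seq mu i | i <- s] ->
    (forall i, i \in s -> W (iter e (shift (mu i)) (q i))) ->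
  W (\sum_(i <- s) q i) -> forall i, i \in s -> W (q i).
Proof.
elim: s q => // j s IHs q /= /andP[mujs us] Wq; rewrite big_cons => Wsum.
have Ws i : i \in s -> W (q i).
  move=> si; have := Wq i; rewrite inE si orbT => /(_ isT) Wqi.
  apply: (@mem_of_iter_shift e e (mu j) (mu i)) => //.
    by apply: contraNneq mujs => ->; apply: map_f.
  apply: (IHs (fun i => iter e (shift (mu j)) (q i))) si => // [j' sj|].
    rewrite iter_shiftCC; apply: iter_shift_mem; apply: Wq.
    by rewrite inE sj orbT.
  (* The tail is the total sum minus [q j], and the power of [shift (mu j)] maps both into [W]. *)
  rewrite -iter_shift_sum -(addrK (q j) (\sum_(i <- s) _)) [_ + q j]addrC.
  rewrite iter_shiftB; apply: WB; first exact: iter_shift_mem.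
  by apply: Wq; rewrite inE eqxx.
move=> i; rewrite inE => /predU1P[->|/Ws//].
rewrite -(addrK (\sum_(i <- s) q i) (q j)); apply: WB => //.
by rewrite big_seq; elim/big_ind: _.
Qed.

End EigencomponentsInInvariantSubspace.

(** * Dickson's lemma for exponent vectors *)

Section Dickson.
Context (n : nat).
Implicit Types (S : set 'X_{1..n}) (a m : 'X_{1..n}) (s : seq 'X_{1..n}).

(* Dominating only the first j exponents lets the induction run on j with the
   type of monomials fixed. *)
Lemma dickson_prefix (j : nat) S : exists s, (forall a, a \in s -> S a) /\
  forall m, S m -> exists2 a, a \in s &
    forall i : 'I_n, (i < j)%N -> (a i <= m i)%N.
Proof.
elim: j S => [|j IHj] S.
  have [[a Sa]|S0] := pselect (exists a, S a).
    exists [:: a]; split=> [b|m _]; first by rewrite inE => /eqP->.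
    by exists a; rewrite ?inE.
  by exists [::]; split=> // m Sm; case: S0; exists m.
have [s [sS sP]] := IHj S.
have [jn|nj] := ltnP j n; last first.
  exists s; split=> // m /sP[a sa aP]; exists a => // i _.
  by apply: aP; apply: leq_trans nj.
(* Exponents with [m i0 >= M] are dominated by elements of [s] at [i0] too; each of the finitely
   many slices [m i0 = c] with [c < M] gets its own list [t c]. *)
pose i0 := Ordinal jn; pose M := \max_(a <- s) a i0.
have tex (c : nat) : exists t : seq 'X_{1..n},
    (forall a, a \in t -> S a /\ a i0 = c) /\
    (forall m, S m -> m i0 = c -> exists2 a, a \in t &
      forall i : 'I_n, (i < j)%N -> (a i <= m i)%N).
  have [t [tS tP]] := IHj (fun m => S m /\ m i0 = c).
  by exists t; split=> // m Sm mc; apply: tP.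
have [t tP] := choice tex.
exists (s ++ flatten [seq t c | c <- iota 0 M]); split=> [a|m Sm].
  rewrite mem_cat => /orP[/sS//|/flattenP[_ /mapP[c _ ->]]].
  by case: (tP c) => tS _ /tS[].
have [Mm|mM] := leqP M (m i0).
  have [a sa aP] := sP m Sm; exists a => [|i]; first by rewrite mem_cat sa.
  rewrite ltnS leq_eqVlt => /predU1P[ij|/aP//].
  have -> : i = i0 by apply: val_inj.
  by apply: leq_trans Mm; rewrite /M (big_rem a) //= leq_maxl.
have [tS /(_ m Sm erefl)[a ta aP]] := tP (m i0); exists a => [|i].
  rewrite mem_cat; apply/orP; right; apply/flattenP; exists (t (m i0)) => //.
  by apply: map_f; rewrite mem_iota.
rewrite ltnS leq_eqVlt => /predU1P[ij|/aP//].
have -> : i = i0 by apply: val_inj.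
by case: (tS a ta) => _ ->.
Qed.

Lemma dickson S : exists s, (forall a, a \in s -> S a) /\
  forall m, S m -> exists2 a, a \in s & (a <= m)%MM.
Proof.
have [s [sS sP]] := dickson_prefix n S; exists s; split=> // m /sP[a sa aP].
by exists a => //; apply/mnm_lepP => i; apply: aP.
Qed.

End Dickson.

(** * Power series: module structure, monomials, order of vanishing *)

Section PowerSeries.
Context (n : nat) (K : comNzRingType).
Implicit Types (p q r : {fps K[n]}) (a b m : 'X_{1..n}) (c : K) (d : nat).

Fact fps_scaleA c c' p : fpsC n c * (fpsC n c' * p) = fpsC n (c * c') * p.
Proof. by apply: fpsP => m; rewrite !coefCM mulrA. Qed.
Fact fps_scale1 p : fpsC n 1 * p = p.
Proof. by apply: fpsP => m; rewrite coefCM mul1r. Qed.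
Fact fps_scaleDr c : {morph (fun p => fpsC n c * p) : p q / p + q}.
Proof. by move=> p q; rewrite mulrDr. Qed.
Fact fps_scaleDl p : {morph (fun c => fpsC n c * p) : c c' / c + c'}.
Proof. by move=> c c'; apply: fpsP => m; rewrite coefD !coefCM mulrDl. Qed.

HB.instance Definition _ := GRing.Zmodule_isLmodule.Build K {fps K[n]}
  fps_scaleA fps_scale1 fps_scaleDr fps_scaleDl.

Lemma scale_fpsE c p : c *: p = fpsC n c * p. Proof. by []. Qed.

Lemma coefZ c p m : coef (c *: p) m = c * coef p m.
Proof. exact: coefCM. Qed.

Lemma coefN p m : coef (- p) m = - coef p m. Proof. by []. Qed.

Lemma coefB p q m : coef (p - q) m = coef p m - coef q m. Proof. by []. Qed.

Lemma coefM_neq0 p q m : coef (p * q) m != 0 ->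
  exists a b, [/\ m = (a + b)%MM, coef p a != 0 & coef q b != 0].
Proof.
apply: contra_neqP => pq0; apply: big1 => -[a b] /= /eqP mab.
have [pa|/negP pa] := eqVneq (coef p a) 0; first by rewrite pa mul0r.
have [qb|/negP qb] := eqVneq (coef q b) 0; first by rewrite qb mulr0.
by case: pq0; exists a, b; split=> //; apply/negP.
Qed.

Definition fpsXm a : {fps K[n]} := Fps (fun m => (m == a)%:R).

Lemma coef_Xm a m : coef (fpsXm a) m = (m == a)%:R. Proof. by []. Qed.

Lemma coef_XmM a p m : coef (fpsXm a * p) (a + m)%MM = coef p m.
Proof.
set d := (mdeg (a + m)%MM).+1.
rewrite (@coefM_trunc _ _ d) //.
have -> : (fps_trunc d (fpsXm a) * fps_trunc d p)@_(a + m)%MM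
    = (fps_trunc d p * 'X_[a])@_(a + m)%MM.
  rewrite [in RHS]mulrC; apply: mcoeffM_eq => // k km.
  by rewrite coef_trunc // mcoeffX eq_sym.
by rewrite mcoeffMX coef_trunc // ltnS mdegD leq_addl.
Qed.

Lemma coef_XmM_eq0 a p m : ~~ (a <= m)%MM -> coef (fpsXm a * p) m = 0.
Proof.
apply: contraNeq => /coefM_neq0[k [l [-> + _]]].
by rewrite coef_Xm; have [->|_] := eqVneq k a; rewrite ?lem_addr ?eqxx.
Qed.

Lemma fpsXmD a b : fpsXm (a + b) = fpsXm a * fpsXm b.
Proof.
apply: fpsP => m; have [am|am] := boolP (a <= m)%MM; last first.
  rewrite coef_XmM_eq0 // coef_Xm; case: eqP am => // ->.
  by rewrite lem_addr.
by rewrite -(submK am) [(_ - a + a)%MM]addmC coef_XmM !coef_Xm eqm_add2l.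
Qed.

Lemma fpsXm0 : fpsXm 0%MM = 1.
Proof. by apply: fpsP => m. Qed.

(** Membership in M^d, where M is the ideal generated by the variables. *)
Definition order_ge d p := forall m, (mdeg m < d)%N -> coef p m = 0.
Arguments order_ge : simpl never.

Lemma order_geP d p :
  (forall m, coef p m != 0 -> (d <= mdeg m)%N) -> order_ge d p.
Proof.
by move=> dP m; rewrite ltnNge; apply: contraNeq => /dP.
Qed.

Lemma order_ge_deg d p m : order_ge d p -> coef p m != 0 -> (d <= mdeg m)%N.
Proof. by move=> dp; rewrite leqNgt; apply: contraNN => /dp->. Qed.

Lemma order_geW d e p : (e <= d)%N -> order_ge d p -> order_ge e p.
Proof. by move=> ed dp m me; apply: dp; apply: leq_trans ed. Qed.

Lemma order_ge_0 d : order_ge d 0. Proof. by move=> m _; rewrite coef0. Qed.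

Lemma order_geD d p q : order_ge d p -> order_ge d q -> order_ge d (p + q).
Proof. by move=> dp dq m md; rewrite coefD dp ?dq ?addr0. Qed.

Lemma order_geN d p : order_ge d p -> order_ge d (- p).
Proof. by move=> dp m md; rewrite coefN dp ?oppr0. Qed.

Lemma order_geB d p q : order_ge d p -> order_ge d q -> order_ge d (p - q).
Proof. by move=> dp dq; apply/order_geD/order_geN. Qed.

Lemma order_geM d e p q :
  order_ge d p -> order_ge e q -> order_ge (d + e) (p * q).
Proof.
move=> dp eq; apply: order_geP => m /coefM_neq0[a [b [-> pa qb]]].
by rewrite mdegD leq_add ?(order_ge_deg dp) ?(order_ge_deg eq).
Qed.

Lemma order_geMl d p q : order_ge d q -> order_ge d (p * q).
Proof. exact: (@order_geM 0 d). Qed.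

Lemma order_ge_sum d (J : Type) (s : seq J) (P : pred J) (F : J -> {fps K[n]}) :
  (forall i, P i -> order_ge d (F i)) -> order_ge d (\sum_(i <- s | P i) F i).
Proof.
by move=> dF; elim/big_ind: _ => //; [exact: order_ge_0 | exact: order_geD].
Qed.

Lemma order_ge_eq0 p : (forall d, order_ge d p) -> p = 0.
Proof. by move=> dp; apply: fpsP => m; rewrite coef0 (dp (mdeg m).+1). Qed.

Lemma order_ge_Xm a : order_ge (mdeg a) (fpsXm a).
Proof.
by apply: order_geP => m; rewrite coef_Xm; case: (m =P a) => [->|]; rewrite ?eqxx.
Qed.

Lemma sub_trunc_order_ge d p :
  order_ge d (p - \sum_(m : 'X_{1..n < d}) coef p m *: fpsXm m).
Proof.
move=> m md; rewrite coefB coef_sum (bigD1 (BMultinom md)) // big1 => [|k km].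
  by rewrite [X in _ - X]addr0 coefZ coef_Xm eqxx mulr1 subrr.
rewrite coefZ coef_Xm; case: eqP => [mk|]; last by rewrite mulr0.
by case/eqP: km; apply: val_inj.
Qed.

End PowerSeries.

(** * Ideals are closed in the M-adic topology *)

Section IdealsAreClosed.
Context (n : nat) (K : fieldType) (I : set {fps K[n]}).
Hypothesis idealI : is_ideal I.
Implicit Types (p q g : {fps K[n]}) (a b m : 'X_{1..n}) (d : nat).

Lemma ideal0 : I 0. Proof. by case: idealI. Qed.

Lemma idealD p q : I p -> I q -> I (p + q).
Proof. by case: idealI => _ + _; apply. Qed.

Lemma idealM p q : I q -> I (p * q). Proof. by case: idealI => _ _; apply. Qed.

Lemma idealB p q : I p -> I q -> I (p - q).
Proof. by move=> Ip Iq; rewrite -mulN1r; apply: idealD => //; apply: idealM. Qed.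

Lemma ideal_sum (J : Type) (s : seq J) (P : pred J) (F : J -> {fps K[n]}) :
  (forall i, P i -> I (F i)) -> I (\sum_(i <- s | P i) F i).
Proof.
by move=> IF; elim/big_ind: _ => //; [exact: ideal0 | exact: idealD].
Qed.

Definition adic_closure p := forall d, exists2 q, I q & order_ge d (p - q).

Lemma adic_closureB p q : adic_closure p -> I q -> adic_closure (p - q).
Proof.
move=> clp Iq d; have [r Ir pr] := clp d; exists (r - q); first exact: idealB.
by rewrite opprB addrA addrNK.
Qed.

(** The order on exponents compares degrees first, so a lowest exponent also has minimal degree;
    this ties division to the M-adic topology. *)
Definition lowest p a := coef p a != 0 /\ forall m, (m < a)%O -> coef p m = 0.

Lemma lowest_exists p m : coef p m != 0 -> exists2 a, lowest p a & (a <= m)%O.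
Proof.
elim/(@ltmwf n): m => m IHm pm.
have [[k [km pk]]|no] := pselect (exists k, (k < m)%O /\ coef p k != 0).
  by have [a pa ak] := IHm k km pk; exists a => //; apply: le_trans (ltW km).
exists m => //; split=> // k km; apply/eqP/negP => pk.
by case: no; exists k; split=> //; apply/negP.
Qed.

Lemma lowest_order_ge p a : lowest p a -> order_ge (mdeg a) p.
Proof. by case=> _ pa m /lt_mdeg_ltmc/pa. Qed.

(** An element of [I] congruent to [p] modulo M^(deg a + 1) agrees with [p] at all exponents up to
    [a]. Hence the closure has no new lowest exponents. *)
Lemma lowest_adic_closure p a :
  adic_closure p -> lowest p a -> exists2 q, I q & lowest q a.
Proof.
move=> /(_ (mdeg a).+1)[q Iq pq] [pa p0]; exists q => //.
have qp m : (m <= a)%O -> coef q m = coef p m.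
  by move=> /lemc_mdeg ma; apply/esym/eqP; rewrite -subr_eq0 -coefB pq.
by split=> [|m ma]; rewrite qp // ?p0 // ltW.
Qed.

Lemma coef_XmM_lt g a b m :
  lowest g a -> (m < (b + a)%MM)%O -> coef (fpsXm K b * g) m = 0.
Proof.
case=> _ ga; apply: contraTeq => /coefM_neq0[k [l [-> + gl]]].
rewrite coef_Xm; have [->|] := eqVneq k b; last by rewrite eqxx.
move=> _; rewrite -leNgt lemc_add2r leNgt.
by apply: contraNN gl => /ga->.
Qed.

Section Division.
Context (s : seq 'X_{1..n}) (g : 'X_{1..n} -> {fps K[n]}).
Hypotheses (us : uniq s) (gI : forall a, a \in s -> I (g a)).
Hypothesis (g_lowest : forall a, a \in s -> lowest (g a) a).
Hypothesis (s_dominates : forall p a', adic_closure p -> lowest p a' ->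
  exists2 a, a \in s & (a <= a')%MM).

(** [h] is the multiple of x^(a-b) that matches the lowest terms; the order being compatible with
    addition, nothing below [a] is disturbed. The order of [h] is recorded for the convergence of
    the quotients. *)
Lemma cancel_lowest d p a : adic_closure p -> lowest p a ->
  exists b h, [/\ b \in s, order_ge (mdeg a - mdeg b) h &
    forall m, (m <= a)%O -> coef (p - h * g b) m = 0].
Proof.
move=> clp pa; have [b sb ba] := s_dominates clp pa.
have [gb _] := g_lowest sb; have abK : (a - b + b)%MM = a by rewrite submK.
exists b, ((coef p a / coef (g b) b) *: fpsXm K (a - b)); split=> // [|m].
  have <- : mdeg (a - b) = (mdeg a - mdeg b)%N.
    by rewrite -[in RHS]abK mdegD addnK.
  by move=> m md; rewrite coefZ order_ge_Xm ?mulr0.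
rewrite coefB scale_fpsE -mulrA coefCM le_eqVlt => /predU1P[->|ma].
  rewrite -[X in coef _ X - _ * _]abK -[X in coef (_ * _) X]abK coef_XmM abK.
  by rewrite divfK // subrr.
case: pa => _ /(_ m ma) ->; rewrite (coef_XmM_lt (g_lowest sb)) ?mulr0 ?subrr //.
by rewrite abK.
Qed.

Lemma division_step d p : adic_closure p -> order_ge d p ->
  exists c, (forall a, order_ge (d - mdeg a) (c a)) /\
    order_ge d.+1 (p - \sum_(a <- s) c a * g a).
Proof.
(* [T p] holds the exponents of degree at most [d] not below the lowest exponent of [p]. Unlike the
   support, it shrinks at each cancellation, which may create new coefficients but only above
   [a]. *)
pose T p := [pred m : 'X_{1..n < d.+1} |
  `[< exists2 m' : 'X_{1..n}, (m' <= bmnm m)%O & coef p m' != 0 >]].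
have [k] := ubnP #|T p|; elim: k p => // k IHk p Tp clp dp.
have [pd1|] := pselect (order_ge d.+1 p).
  exists (fun=> 0); split=> [a|]; first exact: order_ge_0.
  by rewrite big1 ?subr0 // => a _; rewrite mul0r.
move=> /existsNP[m /not_implyP[md /eqP pm]].
have [a pa am] := lowest_exists pm.
have ad : mdeg a = d.
  apply/eqP; rewrite eqn_leq (order_ge_deg dp) ?andbT; last by case: pa.
  by rewrite -ltnS; apply: leq_ltn_trans md; apply: lemc_mdeg.
have [b [h [sb hb p'0]]] := cancel_lowest d clp pa.
rewrite ad in hb; set p' := p - h * g b in p'0 *.
have [|||c [cd cP]] := IHk p'.
- rewrite -ltnS; apply: leq_trans Tp; rewrite ltnS.
  apply/proper_card/properP; split.
    apply/fintype.subsetP => m' /asboolP[m1 m1m' p'm1].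
    apply/asboolP; exists a; last by case: pa.
    apply: ltW; rewrite ltNge; apply/negP => m'a.
    by case/eqP: p'm1; apply: p'0; apply: le_trans m'a.
  have ad1 : (mdeg a < d.+1)%N by rewrite ad.
  exists (BMultinom ad1); first by apply/asboolP; exists a => //; case: pa.
  by apply/negP => /asboolP[m1 m1a]; rewrite p'0 ?eqxx.
- exact/adic_closureB/idealM/gI.
- apply: order_geB => //.
  apply: order_geW (order_geM hb (lowest_order_ge (g_lowest sb))).
  by rewrite addnC -leq_subLR.
exists (fun x => c x + (if x == b then h else 0)); split=> [x|].
  by apply: order_geD => //; case: eqP => [->|_] //; apply: order_ge_0.
have -> : \sum_(i <- s) (c i + if i == b then h else 0) * g i
    = \sum_(i <- s) c i * g i + h * g b.
  under eq_bigr do rewrite mulrDl.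
  rewrite big_split; congr (_ + _).
  rewrite (bigD1_seq b sb us) /= eqxx big1 ?addr0 // => i /negPf->.
  exact: mul0r.
by rewrite opprD addrA addrAC.
Qed.

(* C d is a tuple of quotients modulo M^d; the increment of C d a has order at
   least d - mdeg a, so that C converges coefficientwise. *)
Lemma adic_closure_division p :
  adic_closure p -> exists c, p = \sum_(a <- s) c a * g a.
Proof.
move=> clp; pose comb c := \sum_(a <- s) c a * g a.
have Icomb c : I (comb c).
  by rewrite /comb big_seq; apply: ideal_sum => a sa; apply/idealM/gI.
(* The hypotheses sit under the existential, with quotient 0 when they fail, so that [choice] yields
   one total function of the degree and the remainder. *)
have stepE (x : nat * {fps K[n]}) : exists c : 'X_{1..n} -> {fps K[n]},
    adic_closure x.2 -> order_ge x.1 x.2 ->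
    (forall a, order_ge (x.1 - mdeg a) (c a)) /\ order_ge x.1.+1 (x.2 - comb c).
  have [clx|] := pselect (adic_closure x.2); last by exists (fun=> 0).
  have [dx|] := pselect (order_ge x.1 x.2); last by exists (fun=> 0).
  by have [c cP] := division_step clx dx; exists c.
have [step stepP] := choice stepE.
pose fix C d : 'X_{1..n} -> {fps K[n]} :=
  if d is e.+1 then fun a => C e a + step (e, p - comb (C e)) a else fun=> 0.
have Crem d : order_ge d (p - comb (C d)).
  elim: d => [//|d IHd].
  have [_] := stepP (d, _) (adic_closureB clp (Icomb (C d))) IHd.
  rewrite -addrA -opprD /comb -big_split /=.
  by under eq_bigr do rewrite -mulrDl.
have Cstep d a m :
    (mdeg m + mdeg a < d)%N -> coef (C d.+1 a) m = coef (C d a) m.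
  move=> mad; rewrite coefD.
  (* The correction added at stage [d] has order at least [d - mdeg a], which exceeds the degree of
     [m]. *)
  have [+ _] := stepP (d, _) (adic_closureB clp (Icomb (C d))) (Crem d).
  by move=> /(_ a m)->; rewrite ?addr0 //= ltn_subRL addnC.
(* The coefficient at [m] of [C d a] no longer changes from this index on, so [A a] is the limit. *)
pose A a : {fps K[n]} := Fps (fun m => coef (C (mdeg m + mdeg a).+1 a) m).
have AC d a : order_ge (d - mdeg a) (A a - C d a).
  move=> m; rewrite ltn_subRL addnC => mad; rewrite coefB.
  apply/eqP; rewrite subr_eq0 eq_sym; apply/eqP.
  rewrite -(subnKC mad); elim: (d - _)%N => [|e IHe]; first by rewrite addn0.
  by rewrite addnS Cstep // ltn_addr.
exists A; apply/eqP; rewrite -subr_eq0; apply/eqP/order_ge_eq0 => d.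
(* For every [d], both the remainder at stage [d] and the contribution of the later corrections lie
   in M^d. *)
have -> : p - comb A = p - comb (C d) - \sum_(a <- s) (A a - C d a) * g a.
  under eq_bigr do rewrite mulrBl.
  by rewrite sumrB opprB addrA addrNK.
apply: order_geB => //; rewrite big_seq; apply: order_ge_sum => a sa.
apply: order_geW (order_geM (AC d a) (lowest_order_ge (g_lowest sa))).
by rewrite addnC -leq_subLR.
Qed.

End Division.

(** Dickson's lemma is applied to the lowest exponents of elements of [I]; by [lowest_adic_closure]
    the resulting list dominates those of the closure as well, as division demands. *)
Lemma ideal_adic_closed p : adic_closure p -> I p.
Proof.
pose S : set 'X_{1..n} := fun a => exists2 q, I q & lowest q a.
have [s0 [s0S s0P]] := dickson S; pose s := undup s0.
have gE a : exists q, a \in s -> I q /\ lowest q a.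
  have [sa|] := boolP (a \in s); last by exists 0.
  by move: sa; rewrite mem_undup => /s0S[q Iq qa]; exists q.
have [g gP] := choice gE.
have gI a : a \in s -> I (g a) by move=> /gP[].
have gl a : a \in s -> lowest (g a) a by move=> /gP[].
move=> clp; have [|c ->] := adic_closure_division (undup_uniq s0) gI gl _ clp.
  move=> q a' clq qa'; have [a sa aa'] := s0P a' (lowest_adic_closure clq qa').
  by exists a; rewrite ?mem_undup.
by rewrite big_seq; apply: ideal_sum => a sa; apply/idealM/gI.
Qed.

End IdealsAreClosed.

(** * Lie derivatives as derivations, and their effect on the order *)

Section LieDerivative.
Context (n : nat) (K : comNzRingType).
Implicit Types (p q : {fps K[n]}) (h : 'cV[{fps K[n]}]_n).
Implicit Types (m : 'X_{1..n}) (d : nat).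

Fact fps_deriv_is_linear i : linear (@fps_deriv n K i).
Proof.
move=> c p q; apply: fpsP => m.
by rewrite coefD coefZ !coef_deriv coefD coefZ mulrnDl mulrnAr.
Qed.

HB.instance Definition _ i :=
  GRing.isLinear.Build K {fps K[n]} {fps K[n]} *:%R (@fps_deriv n K i)
    (fps_deriv_is_linear i).

Lemma fps_derivM i p q :
  fps_deriv i (p * q) = fps_deriv i p * q + p * fps_deriv i q.
Proof.
(* A derivative at [m] reads a coefficient of degree [mdeg m + 1], so truncating below [(mdeg m).+2]
   reduces the claim to polynomials. *)
apply: fpsP => m; rewrite coefD coef_deriv; set d := (mdeg m).+2.
have dk k : (mdeg k <= mdeg m)%N -> (mdeg (k + U_(i))%MM < d)%N.
  by move=> km; rewrite mdegD mdeg1 addn1 ltnS ltnS.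
have dk' k : (mdeg k <= mdeg m)%N -> (mdeg k < d)%N.
  by move=> km; apply: leq_trans km _.
have trunc_deriv r k : (mdeg k <= mdeg m)%N ->
    (fps_trunc d r)^`M(i)@_k = (fps_trunc d (fps_deriv i r))@_k.
  by move=> km; rewrite mcoeff_deriv !coef_trunc ?dk ?dk'.
rewrite (@coefM_trunc _ _ d) ?dk // -mcoeff_deriv mderivM mcoeffD.
rewrite !(@coefM_trunc _ _ d _ _ m) ?dk' //.
by congr (_ + _); apply: mcoeffM_eq => // k km; rewrite trunc_deriv.
Qed.

Lemma fps_deriv1 i : fps_deriv i (1 : {fps K[n]}) = 0.
Proof.
apply: fpsP => m; rewrite coef0 coef_deriv /=.
by rewrite -mdeg_eq0 mdegD mdeg1 addn1 /= mul0rn.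
Qed.

Fact lie_derivative_is_linear h : linear (lie_derivative h).
Proof.
move=> c p q; rewrite /lie_derivative scaler_sumr -big_split /=.
by apply: eq_bigr => i _; rewrite linearP mulrDr !scale_fpsE mulrCA.
Qed.

HB.instance Definition _ h :=
  GRing.isLinear.Build K {fps K[n]} {fps K[n]} *:%R (lie_derivative h)
    (lie_derivative_is_linear h).

Lemma lie_derivativeM h p q :
  lie_derivative h (p * q) = lie_derivative h p * q + p * lie_derivative h q.
Proof.
rewrite /lie_derivative mulr_suml mulr_sumr -big_split /=.
by apply: eq_bigr => i _; rewrite fps_derivM mulrDr mulrA mulrCA.
Qed.

Lemma lie_derivative1 h : lie_derivative h 1 = 0.
Proof. by rewrite /lie_derivative big1 // => i _; rewrite fps_deriv1 mulr0. Qed.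

Lemma lie_derivativeB h h' p :
  lie_derivative (h - h') p = lie_derivative h p - lie_derivative h' p.
Proof.
by rewrite /lie_derivative -sumrB; apply: eq_bigr => i _; rewrite !mxE mulrBl.
Qed.

Lemma lie_derivativeX h i : lie_derivative h (fpsX K i) = h i 0.
Proof.
rewrite /lie_derivative (bigD1 i) //= big1 => [|j ji]; last first.
  rewrite [X in _ * X](_ : _ = 0) ?mulr0 //; apply: fpsP => m.
  rewrite coef0 coef_deriv /=.
  case: eqP => [/mnmP/(_ j)|]; last by rewrite mul0rn.
  by rewrite mnmDE !mnm1E eqxx eq_sym (negbTE ji) addn1.
rewrite addr0 [X in _ * X](_ : _ = 1) ?mulr1 //; apply: fpsP => m.
rewrite coef_deriv /= -[X in _ == X]add0m eqm_add2r.
by case: eqP => [->|_]; rewrite ?mnm0E ?mul0rn.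
Qed.

Lemma order_ge_deriv d i p : order_ge d.+1 p -> order_ge d (fps_deriv i p).
Proof.
by move=> dp m md; rewrite coef_deriv dp ?mul0rn // mdegD mdeg1 addn1.
Qed.

(** Differentiation lowers the order by one and the factor [h i 0] restores it. *)
Lemma order_ge_lie_derivative d h p :
  (forall i, order_ge 1 (h i 0)) -> order_ge d p ->
  order_ge d (lie_derivative h p).
Proof.
case: d => // d h1 dp; apply: order_ge_sum => i _.
by rewrite -add1n; apply: order_geM => //; apply: order_ge_deriv.
Qed.

Lemma order_ge_iter_lie_derivative e d h p :
  (forall i, order_ge 1 (h i 0)) -> order_ge d p ->
  order_ge d (iter e (lie_derivative h) p).
Proof. by move=> h1 dp; elim: e => //= e; apply: order_ge_lie_derivative. Qed.

Lemma iter_linearP (V : lmodType K) (L : {linear V -> V}) e a u v :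
  iter e L (a *: u + v) = a *: iter e L u + iter e L v.
Proof. by elim: e => //= e ->; rewrite linearP. Qed.

(** * A derivation with nilpotent linear part is nilpotent modulo each M^d *)

Section Nilpotent.
Context (h : 'cV[{fps K[n]}]_n) (A : 'M[K]_n) (k : nat).
Hypotheses (h1 : forall i, order_ge 1 (h i 0)).
Hypotheses (hA : forall i j, coef (h i 0) U_(j)%MM = A i j) (Ak : A ^+ k = 0).
Local Notation N := (lie_derivative h).

Definition linear_form (v : 'rV[K]_n) : {fps K[n]} := \sum_j v 0 j *: fpsX K j.

Lemma coef_linear_form v m :
  coef (linear_form v) m = \sum_j v 0 j *+ (m == U_(j)%MM).
Proof.
by rewrite coef_sum; apply: eq_bigr => j _; rewrite coefZ /= mulr_natr.
Qed.

(** [N] sends x_j to [h j 0], whose linear part is row [j] of [A]; thus [A] describes [N] on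
    M/M^2. *)
Lemma lie_derivative_linear_form v :
  order_ge 2 (N (linear_form v) - linear_form (v *m A)).
Proof.
have -> : N (linear_form v) = \sum_j v 0 j *: h j 0.
  rewrite linear_sum; apply: eq_bigr => j _.
  by rewrite linearZ /= lie_derivativeX.
move=> m; rewrite ltnS leq_eqVlt => /orP[/mdeg1P[l /eqP->]|m0]; last first.
  rewrite coefB coef_linear_form coef_sum !big1 ?subrr // => j _.
    by case: eqP m0 => // ->; rewrite mdeg1.
  by rewrite coefZ h1 ?mulr0.
rewrite coefB coef_linear_form coef_sum [X in _ - X](bigD1 l) // eqxx.
rewrite [X in _ - (_ + X)]big1 => [|j jl]; last first.
  by rewrite eq_mnm1 eq_sym (negbTE jl).
rewrite addr0 mulr1n mxE -sumrB big1 // => j _.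
by rewrite coefZ hA subrr.
Qed.

Lemma iter_lie_derivativeX i : order_ge 2 (iter k N (fpsX K i)).
Proof.
have step e v :
    order_ge 2 (iter e N (linear_form v) - linear_form (v *m A ^+ e)).
  elim: e => [|e IHe].
    by rewrite /= expr0 mulmx1 subrr; apply: order_ge_0.
  have := order_geD (order_ge_lie_derivative h1 IHe)
    (lie_derivative_linear_form (v *m A ^+ e)).
  by rewrite linearB /= addrA subrK exprSr -mulmxE mulmxA.
have := step k (delta_mx 0 i); rewrite Ak mulmx0.
have -> : linear_form (delta_mx 0 i) = fpsX K i.
  rewrite /linear_form (bigD1 i) //= big1 => [|j ji]; rewrite !mxE ?eqxx /=.
    by rewrite scale1r addr0.
  by rewrite (negbTE ji) scale0r.
by rewrite /linear_form big1 ?subr0 // => j _; rewrite mxE scale0r.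
Qed.

(** In the Leibniz expansion of N^(a+b)(p q) each term applies [N] at least [a] times to [p] or at
    least [b] times to [q], gaining one order. A double induction replaces the binomial formula. *)
Lemma iter_lie_derivativeM a b i j p q :
    order_ge i p -> order_ge j q ->
    order_ge i.+1 (iter a N p) -> order_ge j.+1 (iter b N q) ->
  order_ge (i + j).+1 (iter (a + b) N (p * q)).
Proof.
elim: a b p q => [|a IHa] b p q ip jq.
  move=> /= i1p _. apply: order_ge_iter_lie_derivative => //.
  by rewrite -addSn; apply: order_geM.
elim: b q jq => [|b IHb] q jq.
  move=> _ j1q; rewrite addn0; apply: order_ge_iter_lie_derivative => //.
  by rewrite -addnS; apply: order_geM.
move=> ap bq; rewrite addnS iterSr lie_derivativeM -[X in X + _]scale1r.
rewrite iter_linearP scale1r; apply: order_geD.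
  rewrite addSnnS; apply: IHa => //; first exact: order_ge_lie_derivative.
  by rewrite -iterSr.
by apply: IHb => //; [exact: order_ge_lie_derivative | rewrite -iterSr].
Qed.

(** Each variable factor costs [k] iterations; the extra one serves the constant monomial, where N 1
    = 0. *)
Lemma iter_lie_derivativeXm m :
  order_ge (mdeg m).+1 (iter (k * mdeg m).+1 N (fpsXm K m)).
Proof.
move dE: (mdeg m) => d; elim: d m dE => [|d IHd] m.
  move/eqP; rewrite mdeg_eq0 => /eqP->; rewrite muln0 fpsXm0 /= lie_derivative1.
  exact: order_ge_0.
move=> md; have [i mi] : exists i, (U_(i) <= m)%MM.
  apply: contra_eqP md => no; rewrite mdegE big1 // => i _.
  by apply/eqP; apply: contra_notT no => mi; exists i; rewrite lep1mP.
have md' : mdeg (m - U_(i))%MM = d.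
  by apply/eqP; rewrite -eqSS -md -{2}(submK mi) mdegD mdeg1 addn1.
rewrite -[X in fpsXm K X](submK mi) fpsXmD mulnS addnC -addSn -[d.+1]addn1.
apply: iter_lie_derivativeM; first by rewrite -md'; apply: order_ge_Xm.
- by have := @order_ge_Xm n K U_(i)%MM; rewrite mdeg1.
- by apply: IHd.
- exact: iter_lie_derivativeX.
Qed.

(** Only the monomials of degree exactly [d] matter: those of lower degree are absent, and the part
    of order above [d] keeps its order under [N]. *)
Lemma iter_lie_derivative_order_ge d p :
  order_ge d p -> order_ge d.+1 (iter (k * d).+1 N p).
Proof.
move=> dp.
rewrite -(subrK (\sum_(m : 'X_{1..n < d.+1}) coef p m *: fpsXm K m) p).
rewrite -[X in X + _]scale1r iter_linearP scale1r; apply: order_geD.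
  by apply: order_ge_iter_lie_derivative => //; apply: sub_trunc_order_ge.
have -> e (J : Type) (s : seq J) (F : J -> {fps K[n]}) :
    iter e N (\sum_(i <- s) F i) = \sum_(i <- s) iter e N (F i).
  by elim: e => //= e ->; rewrite linear_sum.
apply: order_ge_sum => m _; rewrite -[_ *: _]addr0 iter_linearP.
have -> e : iter e N 0 = 0 by elim: e => //= e ->; rewrite linear0.
rewrite addr0; have [md|dm|md] := ltngtP (mdeg m) d.
- by rewrite dp // scale0r; apply: order_ge_0.
- by have := valP m; rewrite /= ltnS leqNgt dm.
move=> m' m'd; have := @iter_lie_derivativeXm m.
by rewrite md coefZ => ->; rewrite ?mulr0.
Qed.

Lemma lie_derivative_nilpotent d : exists e, forall p, order_ge d (iter e N p).
Proof.
elim: d => [|d [e eP]]; first by exists 0.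
exists ((k * d).+1 + e) => p; rewrite iterD.
exact: iter_lie_derivative_order_ge.
Qed.

End Nilpotent.

End LieDerivative.

(** * Eigenspaces of the semisimple part, and the invariance of the ideal *)

Section Weights.
Context (n : nat) (K : fieldType) (lambda : 'rV[K]_n).
Implicit Types (p q : {fps K[n]}) (f : 'cV[{fps K[n]}]_n).
Implicit Types (m : 'X_{1..n}) (mu : K).
Local Notation S := (linear_field (diag_mx lambda)).

(** The eigenvalue of L_S on the monomial x^m. *)
Definition weight m : K := \sum_i lambda 0 i *+ m i.

Lemma weightD m m' : weight (m + m')%MM = weight m + weight m'.
Proof.
by rewrite -big_split /=; apply: eq_bigr => i _; rewrite mnmDE mulrnDr.
Qed.

Lemma weight1 i : weight U_(i)%MM = lambda 0 i.
Proof.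
rewrite /weight (bigD1 i) //= mnm1E eqxx big1 ?addr0 // => j ji.
by rewrite mnm1E eq_sym (negbTE ji).
Qed.

Lemma coef_lie_derivative_diag p m :
  coef (lie_derivative S p) m = weight m * coef p m.
Proof.
rewrite lie_derivative_diag coef_sum mulr_suml; apply: eq_bigr => i _.
rewrite -mulrA coefCM mulrnAl -mulrnAr; congr (_ * _).
have [im|im] := boolP (U_(i) <= m)%MM; last first.
  have -> : m i = 0%N by apply/eqP; rewrite -[_ == _]negbK -lep1mP.
  exact: coef_XmM_eq0.
rewrite -{1}(submK im) addmC (coef_XmM U_(i)%MM) coef_deriv submK //.
by rewrite mnmBE mnm1E eqxx subn1 prednK // lt0n -lep1mP.
Qed.

Definition weight_homog mu p := forall m, coef p m != 0 -> weight m = mu.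

Lemma weight_homogM mu nu p q :
  weight_homog mu p -> weight_homog nu q -> weight_homog (mu + nu) (p * q).
Proof.
move=> pmu qnu m /coefM_neq0[a [b [-> pa qb]]].
by rewrite weightD (pmu _ pa) (qnu _ qb).
Qed.

Lemma weight_homog_deriv mu i p :
  weight_homog mu p -> weight_homog (mu - lambda 0 i) (fps_deriv i p).
Proof.
move=> pmu m; rewrite coef_deriv => pm; apply/eqP; rewrite eq_sym subr_eq.
rewrite -(weight1 i) -weightD; apply/eqP/esym/pmu.
by apply: contraNneq pm => ->; rewrite mul0rn.
Qed.

Lemma lie_derivative_weight_homog mu p :
  weight_homog mu p -> lie_derivative S p = mu *: p.
Proof.
move=> pmu; apply: fpsP => m; rewrite coef_lie_derivative_diag coefZ.
by have [->|/pmu->//] := eqVneq (coef p m) 0; rewrite !mulr0.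
Qed.

(** Entry [i] of the vanishing bracket reads lambda_i f_i - L_S(f_i) = 0, and L_S multiplies each
    coefficient by its weight. *)
Lemma poincare_dulac_weight_homog f i :
  poincare_dulac f (diag_mx lambda) -> weight_homog (lambda 0 i) (f i 0).
Proof.
rewrite /poincare_dulac lie_bracket_linear => /matrixP/(_ i 0).
rewrite !mxE => fS m fm.
have /(congr1 (fun p : {fps K[n]} => coef p m)) :
    lambda 0 i *: f i 0 - lie_derivative S (f i 0) = 0.
  rewrite -[RHS]fS; congr (_ - _).
    rewrite (bigD1 i) //= big1 => [|j ji]; rewrite !mxE ?eqxx ?addr0 //.
    by rewrite eq_sym (negbTE ji) -scale_fpsE scale0r.
  by apply: eq_bigr => j _; rewrite mulrC; congr (_ * _); rewrite mxE.
rewrite coefB coefZ coef_lie_derivative_diag coef0 -mulrBl => /eqP.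
by rewrite mulf_eq0 (negbTE fm) orbF subr_eq0 eq_sym => /eqP.
Qed.

(** Multiplying by f_i raises the weight by lambda_i, exactly what the derivative in x_i takes
    away. *)
Lemma weight_homog_lie_derivative f mu p : poincare_dulac f (diag_mx lambda) ->
  weight_homog mu p -> weight_homog mu (lie_derivative f p).
Proof.
move=> fS pmu m; apply: contra_neqP => wm; rewrite coef_sum big1 // => i _.
apply/eqP/negP => /negP fpm; apply: wm.
have -> : mu = lambda 0 i + (mu - lambda 0 i) by rewrite addrC subrK.
apply: weight_homogM fpm; first exact: poincare_dulac_weight_homog.
exact: weight_homog_deriv.
Qed.

Definition weight_part mu p : {fps K[n]} :=
  Fps (fun m => if weight m == mu then coef p m else 0).

Lemma coef_weight_part mu p m :
  coef (weight_part mu p) m = if weight m == mu then coef p m else 0.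
Proof. by []. Qed.

Lemma weight_homog_part mu p : weight_homog mu (weight_part mu p).
Proof.
move=> m; rewrite coef_weight_part.
by case: (weight m =P mu) => //; rewrite eqxx.
Qed.

Definition weights d : seq K := undup [seq weight m | m : 'X_{1..n < d}].

(** Modulo M^d finitely many weights suffice: [phi = 1] recovers [p] and [phi = id] recovers
    L_S(p). *)
Lemma coef_sum_weight_part (phi : K -> K) d p m : (mdeg m < d)%N ->
  coef (\sum_(mu <- weights d) phi mu *: weight_part mu p) m
    = phi (weight m) * coef p m.
Proof.
move=> md; have sm : weight m \in weights d.
  rewrite mem_undup; apply/mapP; exists (BMultinom md) => //.
  by rewrite mem_enum.
rewrite coef_sum (bigD1_seq _ sm (undup_uniq _)) big1 => [|mu mum].
  by rewrite [LHS]addr0 coefZ coef_weight_part eqxx.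
by rewrite coefZ coef_weight_part eq_sym (negbTE mum) mulr0.
Qed.

Lemma lie_invariant_semisimple_part f Bn (I : set {fps K[n]}) :
  at0 f = 0 -> at0 (jacobian f) = diag_mx lambda + Bn -> nilpotent_mx Bn ->
  poincare_dulac f (diag_mx lambda) -> is_ideal I -> lie_invariant f I ->
  lie_invariant S I.
Proof.
move=> f0 Df [k Bnk] fS idealI fI p Ip; apply: ideal_adic_closed => // d.
have order1 (g : 'cV[{fps K[n]}]_n) : at0 g = 0 -> forall i, order_ge 1 (g i 0).
  move=> g0 i m; rewrite ltnS leqn0 mdeg_eq0 => /eqP->.
  by have /matrixP/(_ i 0) := g0; rewrite !mxE.
have S0 : at0 S = 0.
  apply/matrixP => i j; rewrite ord1 mxE coef_linear_field mxE.
  by rewrite big1 // => l _; rewrite eq_sym -mdeg_eq0 mdeg1.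
have fSE i : (f - S) i 0 = f i 0 - S i 0 by rewrite mxE [X in _ + X]mxE.
have N1 i : order_ge 1 ((f - S) i 0).
  by rewrite fSE; apply: order_geB; apply: order1.
have NBn i j : coef ((f - S) i 0) U_(j)%MM = Bn i j.
  rewrite fSE coefB coef_linear_field.
  have /matrixP/(_ i j) := Df; rewrite !mxE coef_deriv mnm0E add0m mulr1n => ->.
  rewrite (bigD1 j) //= eqxx big1 => [|l lj]; last first.
    by rewrite eq_mnm1 eq_sym (negbTE lj).
  by rewrite !mxE addr0 mulr1n addrAC subrr add0r.
have [e nil] := lie_derivative_nilpotent N1 NBn Bnk d.
(* [W] is I + M^d, stable under L_f because both summands are. *)
pose W : set {fps K[n]} := fun u => exists2 a, I a & order_ge d (u - a).
have W0 : W 0 by exists 0; [exact: ideal0 | rewrite subr0; exact: order_ge_0].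
have WD u v : W u -> W v -> W (u + v).
  move=> [a Ia ua] [b Ib vb]; exists (a + b); first exact: idealD.
  by rewrite opprD addrACA; apply: order_geD.
have WZ a u : W u -> W (a *: u).
  move=> [b Ib ub]; exists (a *: b); first exact: idealM.
  by rewrite -scalerBr; apply: order_geMl.
have WL u : W u -> W (lie_derivative f u).
  move=> [b Ib ub]; exists (lie_derivative f b); first exact: fI.
  by rewrite -linearB; apply: order_ge_lie_derivative => //; apply: order1.
have Word u : order_ge d u -> W u by exists 0; rewrite ?subr0 //; apply: ideal0.
(* On weight [mu] the operator L_S is the scalar [mu], so L_f - mu is N = L_(f-S). Homogeneity is
   carried along because the identity is needed again at each iterate. *)
have shiftN mu q j : weight_homog mu q ->
    weight_homog mu (iter j (lie_derivative (f - S)) q) /\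
    iter j (shift (lie_derivative f) mu) q = iter j (lie_derivative (f - S)) q.
  move=> qmu; elim: j => //= j [Nq ->].
  have E : shift (lie_derivative f) mu (iter j (lie_derivative (f - S)) q)
      = lie_derivative (f - S) (iter j (lie_derivative (f - S)) q).
    by rewrite lie_derivativeB (lie_derivative_weight_homog Nq).
  split=> //; rewrite -E => m; apply: contra_neqP => wm.
  rewrite coefB coefZ; have -> : coef (iter j (lie_derivative (f - S)) q) m = 0.
    by apply/eqP/negP => /negP/Nq.
  rewrite mulr0 subr0; apply/eqP/negP => /negP.
  by move/(weight_homog_lie_derivative fS Nq).
have Wp : W (\sum_(mu <- weights d) weight_part mu p).
  exists p => // m md; rewrite coefB.
  have := coef_sum_weight_part (fun=> 1) p md.
  by under eq_bigr do rewrite scale1r; rewrite mul1r => ->; rewrite subrr.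
have Wpart mu : mu \in weights d -> W (weight_part mu p).
  (* The weights serve as their own eigenvalues; the e-th power of the shift sends each part into
     M^d, hence into [W]. *)
  apply: (@mem_eigencomponent _ _ (lie_derivative f) W W0 WD WZ WL _ id
    (weight_part^~ p) e) => //; first by rewrite map_id undup_uniq.
  move=> nu _; have [_ ->] := shiftN nu _ e (@weight_homog_part nu p).
  exact: Word.
(* Modulo M^d this combination is L_S(p), so [a] approximates L_S(p) inside [I]. *)
have [a Ia aP] : W (\sum_(mu <- weights d) mu *: weight_part mu p).
  by rewrite big_seq; elim/big_ind: _ => // mu /Wpart; apply: WZ.
exists a => // m md; rewrite -(aP m md) !coefB.
by rewrite (coef_sum_weight_part id) // coef_lie_derivative_diag.
Qed.

End Weights.

Theorem mainTheorem2 (R : realType) (k : base_field) (n : nat)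
    (f : 'cV[{fps (scalars R k)[n]}]_n)
    (Bs Bn : 'M[scalars R k]_n) (lambda : 'rV[scalars R k]_n)
    (I : set {fps (scalars R k)[n]}) :
  at0 f = 0 ->
  jordan_chevalley (at0 (jacobian f)) Bs Bn ->
  Bs = diag_mx lambda ->
  poincare_dulac f Bs ->
  is_ideal I ->
  lie_invariant f I ->
  lie_invariant (linear_field Bs) I.
Proof.
move=> f0 [Df _ _ nilBn] BsE; rewrite {Bs}BsE in Df *.
exact: lie_invariant_semisimple_part f0 Df nilBn.
Qed.
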